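(* Let $\sigma>0$ and $\varphi_L(t,\sigma)=\dfrac{\sigma^2}{\sigma^2+t^2}$, $t\in\mathbb{R}$. Let $\widetilde{\varphi}_L(t,\sigma)=\sum_{k\in\mathbb{Z}}d_{L,k}(\sigma)\,\varphi_L(t-k,\sigma)$ be the basic nod function of the system of integer shifts of $\varphi_L(\cdot,\sigma)$. Then for every $k\in\mathbb{Z}$ its coefficients are given by $$d_{L,k}(\sigma)=\frac{(-1)^{k}\sinh(\sigma\pi)}{\sigma\pi^{2}}\int_{0}^{\pi}\frac{\cos(kt)}{\cosh(\sigma t)}\,dt.$$
   Context: Given a function $\varphi$ on $\mathbb{R}$, the basic nod function (fundamental interpolating function) of the system of its integer shifts is the function $$\widetilde{\varphi}(t)=\sum_{k=-\infty}^{\infty}d_k\,\varphi(t-k),\qquad (d_k)_{k\in\mathbb{Z}}\in\ell_2,$$ satisfying $\widetilde{\varphi}(m)=\delta_{0m}$ for all $m\in\mathbb{Z}$, where $\delta_{0m}$ is the Kronecker symbol. Equivalently, the $d_k$ are the coefficients of the Fourier series $D(t)=\sum_k d_k e^{-ikt}$ with $D(t)\Phi(t)=1$, where $\Phi(t)=\sum_{k}\varphi(k)e^{-ikt}$. *)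

(* Defs.v *)
From Stdlib Require Import Reals ZArith.
From Coquelicot Require Import Coquelicot.

Open Scope R_scope.

(** Convergence of a series indexed by Z: both half-series converge separately.
    For the series used below (products of two square-summable sequences) the
    convergence is absolute, so any other summation convention gives the same
    sums. *)
Definition is_Zseries {V : NormedModule R_AbsRing} (a : Z -> V) (l : V) : Prop :=
  exists lp ln : V,
    is_series (fun n : nat => a (Z.of_nat n)) lp /\
    is_series (fun n : nat => a (- Z.of_nat (S n))%Z) ln /\
    l = plus lp ln.

Definition in_l2 (d : Z -> C) : Prop :=
  exists s : R, is_Zseries (V := R_NormedModule) (fun k => (Cmod (d k)) ^ 2) s.

Definition kronecker (i j : Z) : R := if Z.eqb i j then 1 else 0.

(** [nod] is a basic nod function of the integer shifts of [phi], with
    coefficients [d]. *)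
Definition is_basic_nod (phi : R -> C) (d : Z -> C) (nod : R -> C) : Prop :=
  in_l2 d /\
  (forall t : R,
     is_Zseries (V := C_R_NormedModule) (fun k => Cmult (d k) (phi (t - IZR k))) (nod t)) /\
  (forall m : Z, nod (IZR m) = RtoC (kronecker 0 m)).

Definition phiL (sigma t : R) : R := sigma ^ 2 / (sigma ^ 2 + t ^ 2).

(* Main.v *)
Require Import Defs.
From Stdlib Require Import Reals ZArith Lra Lia Psatz.
From Coquelicot Require Import Coquelicot.

Open Scope R_scope.

(** Write [phi] for [phiL sigma] and [D k] for the asserted value of the
    coefficient. In Fourier terms, [D] is the inverse of the convolution by the
    samples [phi k], because the symbol of these samples has a closed form:
    substituting [PI - t] for the angle,

      sum over k in Z of (-1)^k phi(k) cos(k t)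
        = sigma PI cosh(sigma t) / sinh(sigma PI)     for 0 < t < PI,

    and [D k] is, up to the sign (-1)^k, a cosine coefficient of the reciprocal
    of the right-hand side.

    The closed form ([is_series_symbol]) is obtained without any theorem on
    Fourier inversion. A partial sum u_N of the symbol satisfies
    u_N'' - sigma^2 u_N = - sigma^2 times the alternating Dirichlet kernel.
    Variation of constants from 0 writes u_N(0) cosh(sigma x) - u_N(x) as an
    integral from 0 to x < PI of that kernel against a C^1 function, and this
    tends to 0 by the Riemann-Lebesgue lemma ([riemann_lebesgue]). So the symbol is a multiple of
    cosh(sigma x); integrating from 0 to PI, where only the term k = 0
    contributes, gives the factor.

    Multiplying the closed form by cos(m t) / cosh(sigma t) and integrating
    term by term gives sum_k D_k phi(m - k) = delta_{0m}
    ([nod_coeff_convolution]). Two integrations by parts show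
    D_k = O(1/(1 + k^2)) ([nod_coeff_decay]), so [D] is square summable and
    defines a basic nod function: this is existence.

    For uniqueness, convolve the interpolation conditions of any admissible
    sequence [d] with [D]. Both [D] and the samples of [phi] are absolutely
    summable and [d] is bounded, so the double sum may be reordered, and
    d = (D * phi) * d = D * (phi * d) = D ([convolution_inverse_unique]),
    applied to the real and the imaginary parts of [d]. *)

(** * Series indexed by the integers *)

Lemma is_Zseries_linear {U V : NormedModule R_AbsRing} (f : U -> V)
    (a : Z -> U) (l : U) :
  is_linear f -> is_Zseries a l -> is_Zseries (fun k => f (a k)) (f l).
Proof.
  intros Hf [lp [ln [Hp [Hn ->]]]].
  assert (Hs : forall (u : nat -> U) s, is_series u s -> is_series (fun n => f (u n)) (f s)).
  { intros u s Hu. unfold is_series.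
    apply (filterlim_ext (fun N => f (sum_n u N))).
    - intros N. induction N as [|N IH].
      + now rewrite !sum_O.
      + now rewrite !sum_Sn, (linear_plus f Hf), IH.
    - eapply filterlim_comp; [exact Hu|]. now apply linear_cont. }
  exists (f lp), (f ln).
  split; [|split].
  - now apply (Hs (fun n => a (Z.of_nat n))).
  - now apply (Hs (fun n => a (- Z.of_nat (S n))%Z)).
  - now apply linear_plus.
Qed.

Lemma is_Zseries_ext {V : NormedModule R_AbsRing} (a b : Z -> V) (l : V) :
  (forall k, a k = b k) -> is_Zseries a l -> is_Zseries b l.
Proof.
  intros H [lp [ln [Hp [Hn ->]]]]. exists lp, ln.
  split; [|split; [|reflexivity]]; eapply is_series_ext; try eassumption; intros; apply H.
Qed.

(** The reflection about -1/2 exchanges the two half-series exactly, whereas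
    the reflection about 0 would have to move the term of index 0. *)
Lemma is_Zseries_swap {V : NormedModule R_AbsRing} (a : Z -> V) (l : V) :
  is_Zseries a l -> is_Zseries (fun k => a (-1 - k)%Z) l.
Proof.
  intros [lp [ln [Hp [Hn ->]]]]. exists ln, lp. split; [|split].
  - refine (is_series_ext _ _ _ _ Hn). intros n. cbv beta. apply f_equal. lia.
  - refine (is_series_ext _ _ _ _ Hp). intros n. cbv beta. apply f_equal. lia.
  - apply plus_comm.
Qed.

Lemma plus_opp_cancel {G : AbelianGroup} (x y : G) : plus (plus x (opp y)) y = x.
Proof.
  etransitivity; [symmetry; apply plus_assoc|].
  etransitivity; [apply f_equal, plus_opp_l|apply plus_zero_r].
Qed.

(** One term moves from one half-series to the other, so conditional convergence
    is enough. *)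
Lemma is_Zseries_succ {V : NormedModule R_AbsRing} (a : Z -> V) (l : V) :
  is_Zseries a l -> is_Zseries (fun k => a (k + 1)%Z) l.
Proof.
  intros [lp [ln [Hp [Hn ->]]]].
  exists (plus lp (opp (a 0%Z))), (plus ln (a 0%Z)). split; [|split].
  - apply (is_series_ext (fun n => a (Z.of_nat (S n)))).
    + intros n. apply f_equal. lia.
    + apply (is_series_incr_1 (fun n => a (Z.of_nat n))).
      eapply eq_ind_r; [exact Hp|]. exact (plus_opp_cancel lp (a 0%Z)).
  - apply (is_series_decr_1 (fun n => a (- Z.of_nat (S n) + 1)%Z)).
    eapply eq_ind_r.
    + refine (is_series_ext _ _ _ _ Hn). intros n. cbv beta. apply f_equal. lia.
    + etransitivity; [symmetry; apply plus_assoc|].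
      etransitivity; [exact (f_equal (plus ln) (plus_opp_r (a 0%Z)))|apply plus_zero_r].
  - etransitivity; [|symmetry; apply plus_assoc].
    etransitivity; [|apply f_equal2; [apply plus_comm|reflexivity]].
    etransitivity; [|apply plus_assoc].
    etransitivity; [apply plus_comm|apply f_equal].
    symmetry. exact (plus_opp_cancel lp (a 0%Z)).
Qed.

(** Every reflection of Z is a translation composed with the reflection about
    -1/2, and that reflection also turns translations to the right into
    translations to the left. *)
Lemma is_Zseries_reflect {V : NormedModule R_AbsRing} (n : Z) (a : Z -> V) (l : V) :
  is_Zseries a l -> is_Zseries (fun k => a (n - k)%Z) l.
Proof.
  assert (Hup : forall (p : nat) (b : Z -> V),
             is_Zseries b l -> is_Zseries (fun k => b (k + Z.of_nat p)%Z) l).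
  { induction p as [|p IH]; intros b Hb.
    - refine (is_Zseries_ext _ _ _ _ Hb).  intros k. apply f_equal. lia.
    - eapply is_Zseries_ext; [|exact (IH _ (is_Zseries_succ _ _ Hb))].
      intros k. cbv beta. apply f_equal. lia. }
  intros Ha.
  destruct (Z_le_gt_dec 0 (n + 1)) as [Hn|Hn].
  - eapply is_Zseries_ext;
      [|exact (is_Zseries_swap _ _ (Hup (Z.to_nat (n + 1)) _ Ha))].
    intros k. cbv beta. apply f_equal. lia.
  - eapply is_Zseries_ext;
      [|exact (Hup (Z.to_nat (- (n + 1))) _ (is_Zseries_swap _ _ Ha))].
    intros k. cbv beta. apply f_equal. lia.
Qed.

(** The window runs from -N-1 to N, so that each step adds one term of each
    half-series. *)
Definition zsum (a : Z -> R) (N : nat) : R :=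
  sum_n (fun n => a (Z.of_nat n) + a (- Z.of_nat (S n))%Z) N.

Lemma zsum_0 a : zsum a 0 = a 0%Z + a (-1)%Z.
Proof. unfold zsum. now rewrite sum_O. Qed.

Lemma zsum_S a N :
  zsum a (S N) = zsum a N + (a (Z.of_nat (S N)) + a (- Z.of_nat (S (S N)))%Z).
Proof. unfold zsum. now rewrite sum_Sn. Qed.

Lemma is_lim_zsum a l :
  is_Zseries (V := R_NormedModule) a l -> is_lim_seq (zsum a) l.
Proof.
  intros [lp [ln [Hp [Hn ->]]]]. exact (is_series_plus _ _ _ _ Hp Hn).
Qed.

Lemma zsum_ext a b N : (forall k, a k = b k) -> zsum a N = zsum b N.
Proof. intros H. apply sum_n_ext. intros n. now rewrite !H. Qed.

Lemma zsum_plus a b N : zsum (fun k => a k + b k) N = zsum a N + zsum b N.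
Proof. induction N as [|N IH]; rewrite ?zsum_0, ?zsum_S, ?IH; ring. Qed.

Lemma zsum_scal c a N : zsum (fun k => c * a k) N = c * zsum a N.
Proof. induction N as [|N IH]; rewrite ?zsum_0, ?zsum_S, ?IH; ring. Qed.

Lemma zsum_le a b N : (forall k, a k <= b k) -> zsum a N <= zsum b N.
Proof.
  intros H; induction N as [|N IH]; rewrite ?zsum_0, ?zsum_S.
  - apply Rplus_le_compat; apply H.
  - apply Rplus_le_compat; [exact IH|apply Rplus_le_compat; apply H].
Qed.

Lemma Rabs_zsum a N : Rabs (zsum a N) <= zsum (fun k => Rabs (a k)) N.
Proof.
  induction N as [|N IH]; rewrite ?zsum_0, ?zsum_S.
  - apply Rabs_triang.
  - eapply Rle_trans; [apply Rabs_triang|].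
    apply Rplus_le_compat; [exact IH|apply Rabs_triang].
Qed.

Lemma zsum_switch (f : Z -> Z -> R) M N :
  zsum (fun i => zsum (f i) M) N = zsum (fun j => zsum (fun i => f i j) N) M.
Proof.
  induction N as [|N IH].
  - rewrite zsum_0, <- zsum_plus. apply zsum_ext. intros. now rewrite zsum_0.
  - rewrite zsum_S, IH, <- !zsum_plus. apply zsum_ext. intros. now rewrite zsum_S.
Qed.

Lemma is_lim_zsum_termwise (u : nat -> Z -> R) (v : Z -> R) (K : nat) :
  (forall k, is_lim_seq (fun N => u N k) (v k)) ->
  is_lim_seq (fun N => zsum (u N) K) (zsum v K).
Proof.
  intros Huv. induction K as [|K IH].
  - eapply is_lim_seq_ext; [intros N; symmetry; apply zsum_0|].
    rewrite zsum_0. apply is_lim_seq_plus'; apply Huv.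
  - eapply is_lim_seq_ext; [intros N; symmetry; apply zsum_S|].
    rewrite zsum_S. apply is_lim_seq_plus'; [exact IH|].
    apply is_lim_seq_plus'; apply Huv.
Qed.

Lemma zsum_le_Zseries a l N :
  (forall k, 0 <= a k) -> is_Zseries (V := R_NormedModule) a l -> zsum a N <= l.
Proof.
  intros Ha Hl. apply (is_lim_seq_incr_compare (zsum a)).
  - now apply is_lim_zsum.
  - intros n. rewrite zsum_S.
    pose proof (Ha (Z.of_nat (S n))); pose proof (Ha (- Z.of_nat (S (S n)))%Z). lra.
Qed.

Lemma zsum_kronecker n a : exists N0, forall N, (N0 <= N)%nat ->
  zsum (fun k => kronecker n k * a k) N = a n.
Proof.
  exists (Z.abs_nat n).
  assert (H : forall N, zsum (fun k => kronecker n k * a k) N =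
     if (Z.leb (- Z.of_nat (S N)) n && Z.leb n (Z.of_nat N))%bool then a n else 0).
  { unfold kronecker. induction N as [|N IH].
    - rewrite zsum_0.
      destruct (Z.eqb_spec n 0), (Z.eqb_spec n (-1)), (Z.leb_spec (- Z.of_nat 1) n),
        (Z.leb_spec n (Z.of_nat 0)); subst; cbn [andb]; lia || ring.
    - rewrite zsum_S, IH.
      destruct (Z.eqb_spec n (Z.of_nat (S N))) as [E1|],
        (Z.eqb_spec n (- Z.of_nat (S (S N)))) as [E2|],
        (Z.leb_spec (- Z.of_nat (S N)) n), (Z.leb_spec n (Z.of_nat N)),
        (Z.leb_spec (- Z.of_nat (S (S N))) n), (Z.leb_spec n (Z.of_nat (S N)));
        cbn [andb]; (lia || (try rewrite <- E1; try rewrite <- E2; ring)). }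
  intros N HN. rewrite H.
  destruct (Z.leb_spec (- Z.of_nat (S N)) n), (Z.leb_spec n (Z.of_nat N)); simpl; lia || lra.
Qed.

Lemma Zseries_term_le (a : Z -> R) (l : R) (k : Z) :
  (forall j, 0 <= a j) -> is_Zseries (V := R_NormedModule) a l -> a k <= l.
Proof.
  intros Ha Hl. destruct (zsum_kronecker k a) as [N HN].
  rewrite <- (HN N) by lia. eapply Rle_trans; [|exact (zsum_le_Zseries a l N Ha Hl)].
  apply zsum_le. intros j. unfold kronecker. pose proof (Ha j).
  destruct (Z.eqb k j); lra.
Qed.

(** Comparison with the telescoping series of 1/((n+1)(n+2)):
    (n+1)(n+2) <= 4 (1 + n^2). *)
Lemma ex_series_inv_1_sq (C : R) :
  ex_series (fun n => C / (1 + INR n ^ 2)).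
Proof.
  assert (Htel : is_lim_seq (sum_n (fun n => / (INR n + 1) - / (INR n + 2))) 1).
  { apply (is_lim_seq_ext (fun N => 1 - / (INR N + 2))).
    - induction n as [|n IH].
      + rewrite sum_O. simpl. field.
      + rewrite sum_Sn, <- IH, S_INR. pose proof (pos_INR n).
        change plus with Rplus. field. lra.
    - evar_last.
      + apply is_lim_seq_minus'; [apply is_lim_seq_const|].
        apply (is_lim_seq_inv (fun n => INR n + 2) p_infty); [|discriminate].
        eapply is_lim_seq_plus; [apply is_lim_seq_INR|apply is_lim_seq_const|].
        reflexivity.
      + simpl. f_equal. ring. }
  apply (ex_series_ext (fun n => scal C (/ (1 + INR n ^ 2)))); [reflexivity|].
  apply (@ex_series_scal R_AbsRing R_NormedModule C (fun n => / (1 + INR n ^ 2))).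
  apply (@ex_series_le R_AbsRing R_CompleteNormedModule _
           (fun n => scal 4 (/ (INR n + 1) - / (INR n + 2)))).
  - intros n. change norm with Rabs. change scal with Rmult. pose proof (pos_INR n).
    assert (0 < 1 + INR n ^ 2) by nra.
    rewrite Rabs_pos_eq by (left; now apply Rinv_0_lt_compat).
    replace (4 * (/ (INR n + 1) - / (INR n + 2))) with (/ ((INR n + 1) * (INR n + 2) / 4))
      by (field; lra).
    apply Rinv_le_contravar; nra.
  - apply (@ex_series_scal R_AbsRing R_NormedModule 4 (fun n => / (INR n + 1) - / (INR n + 2))).
    now exists 1.
Qed.

Lemma ex_Zseries_dominated (C : R) (a : Z -> R) :
  (forall k, Rabs (a k) <= C / (1 + IZR k ^ 2)) ->
  exists l, is_Zseries (V := R_NormedModule) a l.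
Proof.
  intros Ha.
  assert (H0 : 0 <= C).
  { pose proof (Ha 0%Z) as H. pose proof (Rabs_pos (a 0%Z)).
    replace (C / (1 + 0 ^ 2)) with C in H by field. lra. }
  assert (Hp : ex_series (fun n => a (Z.of_nat n))).
  { apply (@ex_series_le R_AbsRing R_CompleteNormedModule _ (fun n => C / (1 + INR n ^ 2))).
    - intros n. rewrite INR_IZR_INZ. apply Ha.
    - apply ex_series_inv_1_sq. }
  assert (Hn : ex_series (fun n => a (- Z.of_nat (S n))%Z)).
  { apply (@ex_series_le R_AbsRing R_CompleteNormedModule _ (fun n => C / (1 + INR (S n) ^ 2))).
    - intros n. rewrite INR_IZR_INZ.
      eapply Rle_trans; [apply Ha|].
      rewrite opp_IZR. right. f_equal. ring.
    - apply (ex_series_incr_1 (fun n => C / (1 + INR n ^ 2))), ex_series_inv_1_sq. }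
  destruct Hp as [lp Hp], Hn as [ln Hn].
  exists (plus lp ln), lp, ln. auto.
Qed.

(** * Uniqueness of convolution inverses *)

(** Associativity e = (D * p) * e = D * (p * e), by reordering a double sum.
    Truncate the inner sum over m to a window of size M. Over any window of k,
    what is lost is at most B (sum |p|) times the tail of sum |D| beyond M
    ([Hfin]); this bound does not depend on the window of k, so it survives the
    passage to all k, and it vanishes as M grows. *)
Lemma convolution_inverse_unique (D p e : Z -> R) (B C1 C2 c : R) :
  (forall k, Rabs (D k) <= C1 / (1 + IZR k ^ 2)) ->
  (forall k, Rabs (p k) <= C2 / (1 + IZR k ^ 2)) ->
  (forall k, Rabs (e k) <= B) ->
  (forall m, is_Zseries (V := R_NormedModule) (fun k => D k * p (m - k)%Z) (kronecker 0 m)) ->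
  (forall m, is_Zseries (V := R_NormedModule) (fun k => e k * p (m - k)%Z) (c * kronecker 0 m)) ->
  forall n, e n = c * D n.
Proof.
  intros HD Hp He HDp Hep n.
  destruct (ex_Zseries_dominated C1 (fun k => Rabs (D k))) as [T HS];
    [intros k; rewrite Rabs_Rabsolu; apply HD|].
  destruct (ex_Zseries_dominated C2 (fun k => Rabs (p k))) as [P HP];
    [intros k; rewrite Rabs_Rabsolu; apply Hp|].
  assert (HB : 0 <= B) by (eapply Rle_trans; [apply Rabs_pos|apply (He 0%Z)]).
  set (A := fun m => Rabs (D (n - m)%Z)).
  assert (HA : is_Zseries (V := R_NormedModule) A T) by exact (is_Zseries_reflect n _ _ HS).
  set (f := fun k m => D (n - m)%Z * p (m - k)%Z).
  assert (Hf : forall k, is_lim_seq (zsum (f k)) (kronecker n k)).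
  { intros k. apply is_lim_zsum.
    pose proof (is_Zseries_reflect n _ _ (HDp (n - k)%Z)) as H.
    replace (kronecker 0 (n - k)) with (kronecker n k) in H.
    - eapply is_Zseries_ext; [|exact H]. intros m. cbv beta. unfold f.
      now replace (n - k - (n - m))%Z with (m - k)%Z by lia.
    - unfold kronecker.
      destruct (Z.eqb_spec n k), (Z.eqb_spec 0 (n - k)); auto; lia. }
  assert (Hfin : forall K M M', (M <= M')%nat ->
     Rabs (zsum (fun k => e k * (zsum (f k) M' - zsum (f k) M)) K)
       <= B * P * (zsum A M' - zsum A M)).
  { intros K M M' HM. induction HM as [|M' HM IH].
    - rewrite (zsum_ext _ (fun k => 0 * 0)) by (intros; ring).
      rewrite zsum_scal. right. rewrite Rmult_0_l, Rabs_R0. ring.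
    - rewrite (zsum_ext _ (fun k => e k * (zsum (f k) M' - zsum (f k) M) +
         (D (n - Z.of_nat (S M'))%Z * (e k * p (Z.of_nat (S M') - k)%Z)
         + D (n - - Z.of_nat (S (S M')))%Z
            * (e k * p (- Z.of_nat (S (S M')) - k)%Z)))).
      2:{ intros k. rewrite zsum_S. unfold f. ring. }
      rewrite !zsum_plus, !zsum_scal, (zsum_S A).
      assert (Hcol : forall m, Rabs (zsum (fun k => e k * p (m - k)%Z) K) <= B * P).
      { intros m. eapply Rle_trans; [apply Rabs_zsum|].
        eapply Rle_trans.
        - apply (zsum_le _ (fun k => B * Rabs (p (m - k)%Z))). intros k.
          rewrite Rabs_mult. apply Rmult_le_compat_r; [apply Rabs_pos|apply He].
        - rewrite zsum_scal. apply Rmult_le_compat_l; [exact HB|].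
          apply (zsum_le_Zseries (fun k => Rabs (p (m - k)%Z))); [intros; apply Rabs_pos|].
          exact (is_Zseries_reflect m _ _ HP). }
      assert (Hterm : forall m, Rabs (D (n - m)%Z * zsum (fun k => e k * p (m - k)%Z) K)
                <= B * P * A m).
      { intros m. rewrite Rabs_mult, (Rmult_comm (B * P)).
        apply Rmult_le_compat_l; [apply Rabs_pos|apply Hcol]. }
      eapply Rle_trans; [apply Rabs_triang|].
      eapply Rle_trans; [apply Rplus_le_compat_l, Rabs_triang|].
      pose proof (Hterm (Z.of_nat (S M'))).
      pose proof (Hterm (- Z.of_nat (S (S M')))%Z). lra. }
  (* M' tends to infinity in [Hfin]: the full sum over m of [f k m] is the
     Kronecker symbol. *)
  assert (Hrow : forall K M,
     Rabs (zsum (fun k => e k * ((kronecker n k) - zsum (f k) M)) K)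
       <= B * P * (T - zsum A M)).
  { intros K M.
    apply (is_lim_seq_le
      (fun N => Rabs (zsum (fun k => e k * (zsum (f k) (N + M) - zsum (f k) M)) K))
      (fun N => B * P * (zsum A (N + M) - zsum A M))
      (Finite (Rabs (zsum (fun k => e k * ((kronecker n k) - zsum (f k) M)) K)))
      (Finite (B * P * (T - zsum A M)))).
    - intros N. apply Hfin. lia.
    - apply (is_lim_seq_abs _ (Finite _)), (is_lim_zsum_termwise
        (fun N k => e k * (zsum (f k) (N + M) - zsum (f k) M))).
      intros k. apply (is_lim_seq_scal_l _ _ (Finite _)), is_lim_seq_minus'; [|apply is_lim_seq_const].
      apply is_lim_seq_incr_n with (u := zsum (f k)), Hf.
    - apply (is_lim_seq_scal_l _ _ (Finite _)), is_lim_seq_minus'; [|apply is_lim_seq_const].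
      apply is_lim_seq_incr_n with (u := zsum A), is_lim_zsum, HA. }
  (* K tends to infinity in [Hrow]; swapping the two finite sums turns the sum
     over k into the convolution of [e] with [p]. *)
  assert (Hlim : forall M, Rabs (e n - zsum (fun m => D (n - m)%Z * (c * kronecker 0 m)) M)
       <= B * P * (T - zsum A M)).
  { intros M.
    apply (is_lim_seq_le
      (fun K => Rabs (zsum (fun k => e k * ((kronecker n k) - zsum (f k) M)) K))
      (fun K => B * P * (T - zsum A M)) (Finite _) (Finite _) (fun K => Hrow K M));
      [|apply is_lim_seq_const].
    apply (is_lim_seq_abs _ (Finite _)).
    apply (is_lim_seq_ext (fun K => zsum (fun k => kronecker n k * e k) K
       - zsum (fun m => D (n - m)%Z * zsum (fun k => e k * p (m - k)%Z) K) M)).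
    - intros K.
      rewrite (zsum_ext (fun m => D (n - m)%Z * _)
                 (fun m => zsum (fun k => e k * f k m) K)).
      2:{ intros m. rewrite <- zsum_scal. apply zsum_ext. intros k. unfold f. ring. }
      rewrite zsum_switch.
      replace (zsum (fun k => kronecker n k * e k) K) with
        (zsum (fun k => e k * ((kronecker n k) - zsum (f k) M)) K
         + zsum (fun k => zsum (fun m => e k * f k m) M) K); [ring|].
      rewrite <- zsum_plus. apply zsum_ext. intros k. rewrite zsum_scal. ring.
    - apply is_lim_seq_minus'.
      + destruct (zsum_kronecker n e) as [N0 HN0].
        apply (is_lim_seq_ext_loc (fun _ => e n)); [|apply is_lim_seq_const].
        exists N0. intros K HK. symmetry. now apply HN0.
      + apply (is_lim_zsum_termwise
          (fun K m => D (n - m)%Z * zsum (fun k => e k * p (m - k)%Z) K)).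
        intros m. apply (is_lim_seq_scal_l _ _ (Finite _)), is_lim_zsum, Hep. }
  destruct (zsum_kronecker 0 (fun m => c * D (n - m)%Z)) as [N0 HN0].
  assert (Hle : Rabs (e n - c * D n) <= B * P * (T - T)).
  { apply (is_lim_seq_le_loc
      (fun _ => Rabs (e n - c * D n)) (fun M => B * P * (T - zsum A M))
      (Finite _) (Finite _)).
    - exists N0. intros M HM.
      replace (c * D n) with (zsum (fun m => D (n - m)%Z * (c * kronecker 0 m)) M);
        [apply Hlim|].
      etransitivity; [|rewrite <- (Z.sub_0_r n) at 1; exact (HN0 M HM)].
      apply zsum_ext. intros m. ring.
    - apply is_lim_seq_const.
    - apply (is_lim_seq_scal_l _ _ (Finite _)), is_lim_seq_minus'; [apply is_lim_seq_const|].
      apply is_lim_zsum, HA. }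
  rewrite Rminus_diag, Rmult_0_r in Hle.
  pose proof (Rabs_pos (e n - c * D n)).
  assert (Rabs (e n - c * D n) = 0) as H0 by lra.
  apply Rabs_eq_0 in H0. lra.
Qed.

(** * Oscillatory integrals and decay of cosine coefficients *)

Lemma ex_derive_continuous_R (f : R -> R) (x : R) : ex_derive f x -> continuous f x.
Proof. apply (@ex_derive_continuous R_AbsRing R_NormedModule). Qed.

Lemma continuous_bounded_segment (g : R -> R) (a b : R) :
  a <= b -> (forall x, a <= x <= b -> continuous g x) ->
  exists M, forall x, a <= x <= b -> Rabs (g x) <= M.
Proof.
  intros Hab Hg.
  destruct (continuity_ab_maj (fun x => Rabs (g x)) a b Hab) as [x0 [Hx0 _]].
  - intros x Hx. apply (continuity_pt_comp g Rabs); [|apply Rcontinuity_abs].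
    now apply continuity_pt_filterlim, Hg.
  - now exists (Rabs (g x0)).
Qed.

(** One integration by parts. The constant is uniform in the frequency [lam] and
    the phase [th]; the phase lets the same statement serve sines and cosines. *)
Lemma riemann_lebesgue (g g' : R -> R) (a b : R) :
  a <= b ->
  (forall x, a <= x <= b -> is_derive g x (g' x)) ->
  (forall x, a <= x <= b -> continuous g' x) ->
  exists C, forall lam th,
    Rabs lam * Rabs (RInt (fun s => cos (lam * s + th) * g s) a b) <= C.
Proof.
  intros Hab Hg Hg'.
  destruct (continuous_bounded_segment g' a b Hab Hg') as [M HM].
  exists (Rabs (g b) + Rabs (g a) + (b - a) * M). intros lam th.
  assert (Hmm : forall x, Rmin a b <= x <= Rmax a b -> a <= x <= b).
  { intros x. rewrite Rmin_left, Rmax_right; auto. }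
  assert (Hgc : forall x, a <= x <= b -> continuous g x).
  { intros x Hx. apply ex_derive_continuous_R. eexists. now apply Hg. }
  assert (Hcos : forall x, continuous (fun s => cos (lam * s + th)) x).
  { intros x. apply ex_derive_continuous_R. now auto_derive. }
  assert (Hsin : forall x, continuous (fun s => sin (lam * s + th)) x).
  { intros x. apply ex_derive_continuous_R. now auto_derive. }
  assert (H1 : ex_RInt (fun s => cos (lam * s + th) * g s) a b).
  { apply (@ex_RInt_continuous R_CompleteNormedModule). intros x Hx.
    apply (continuous_mult (K := R_AbsRing)); auto. }
  assert (H2 : ex_RInt (fun s => sin (lam * s + th) * g' s) a b).
  { apply (@ex_RInt_continuous R_CompleteNormedModule). intros x Hx.
    apply (continuous_mult (K := R_AbsRing)); auto. }
  assert (Hparts : lam * RInt (fun s => cos (lam * s + th) * g s) a b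
       + RInt (fun s => sin (lam * s + th) * g' s) a b
     = sin (lam * b + th) * g b - sin (lam * a + th) * g a).
  { apply (@RInt_correct R_CompleteNormedModule) in H1, H2.
    apply (is_RInt_scal (V := R_NormedModule) _ _ _ lam) in H1.
    pose proof (is_RInt_plus (V := R_NormedModule) _ _ _ _ _ _ H1 H2) as H3.
    apply (@is_RInt_unique R_CompleteNormedModule) in H3.
    etransitivity; [symmetry; exact H3|].
    apply (@is_RInt_unique R_CompleteNormedModule).
    apply (@is_RInt_derive R_CompleteNormedModule (fun s => sin (lam * s + th) * g s)).
    - intros x Hx. evar_last.
      + apply (@is_derive_mult R_AbsRing (fun s => sin (lam * s + th)) g x).
        * auto_derive; [trivial|reflexivity].
        * now apply Hg, Hmm.
        * intros; apply Rmult_comm.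
      + change plus with Rplus. change mult with Rmult. change scal with Rmult. cbv beta. ring.
    - intros x Hx. apply (continuous_plus (V := R_NormedModule)).
      + apply (continuous_mult (K := R_AbsRing) (fun _ => lam));
          [apply continuous_const|apply (continuous_mult (K := R_AbsRing)); auto].
      + apply (continuous_mult (K := R_AbsRing)); auto. }
  assert (Hrem : Rabs (RInt (fun s => sin (lam * s + th) * g' s) a b) <= (b - a) * M).
  { apply abs_RInt_le_const; auto. intros t Ht. rewrite Rabs_mult.
    pose proof (HM t Ht). pose proof (Rabs_pos (g' t)).
    assert (Rabs (sin (lam * t + th)) <= 1) by (apply Rabs_le, SIN_bound).
    pose proof (Rabs_pos (sin (lam * t + th))). nra. }
  rewrite <- Rabs_mult.
  replace (lam * _) with (sin (lam * b + th) * g b + - (sin (lam * a + th) * g a)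
     + - RInt (fun s => sin (lam * s + th) * g' s) a b) by lra.
  assert (Hend : forall x, Rabs (sin (lam * x + th) * g x) <= Rabs (g x)).
  { intros x. rewrite Rabs_mult. pose proof (Rabs_pos (g x)).
    assert (Rabs (sin (lam * x + th)) <= 1) by (apply Rabs_le, SIN_bound). nra. }
  eapply Rle_trans; [apply Rabs_triang|]. rewrite Rabs_Ropp.
  eapply Rle_trans; [apply Rplus_le_compat_r, Rabs_triang|]. rewrite Rabs_Ropp.
  pose proof (Hend a). pose proof (Hend b). lra.
Qed.

Lemma sin_IZR_PI (k : Z) : sin (IZR k * PI) = 0.
Proof. apply sin_eq_0_1. now exists k. Qed.

(** Two integrations by parts: in the first, the boundary terms vanish because
    sin(k t) is 0 at both 0 and PI; the second is [riemann_lebesgue] for the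
    derivative of [w]. *)
Lemma cosine_coefficients_decay (w w1 w2 : R -> R) :
  (forall x, 0 <= x <= PI -> is_derive w x (w1 x)) ->
  (forall x, 0 <= x <= PI -> is_derive w1 x (w2 x)) ->
  (forall x, 0 <= x <= PI -> continuous w2 x) ->
  exists C, forall k : Z,
    Rabs (RInt (fun t => cos (IZR k * t) * w t) 0 PI) <= C / (1 + IZR k ^ 2).
Proof.
  intros Hw Hw1 Hw2.
  assert (HPI := PI_RGT_0).
  destruct (riemann_lebesgue w1 w2 0 PI) as [C HC]; auto; [lra|].
  assert (Hmm : forall x, Rmin 0 PI <= x <= Rmax 0 PI -> 0 <= x <= PI).
  { intros x. rewrite Rmin_left, Rmax_right; lra. }
  assert (Hwc : forall x, 0 <= x <= PI -> continuous w x).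
  { intros x Hx. apply ex_derive_continuous_R. eexists. now apply Hw. }
  assert (Hw1c : forall x, 0 <= x <= PI -> continuous w1 x).
  { intros x Hx. apply ex_derive_continuous_R. eexists. now apply Hw1. }
  destruct (continuous_bounded_segment w 0 PI) as [M HM]; auto; [lra|].
  exists (C + PI * M). intros k.
  set (E := RInt (fun t => cos (IZR k * t) * w t) 0 PI).
  (* The phase -PI/2 below turns the cosine into a sine. *)
  assert (Hcos : forall th x, continuous (fun s => cos (IZR k * s + th)) x).
  { intros th x. apply ex_derive_continuous_R. now auto_derive. }
  assert (Hcos0 : forall x, continuous (fun s => cos (IZR k * s)) x).
  { intros x. apply ex_derive_continuous_R. now auto_derive. }
  assert (H1 : ex_RInt (fun s => cos (IZR k * s) * w s) 0 PI).
  { apply (@ex_RInt_continuous R_CompleteNormedModule). intros x Hx.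
    apply (continuous_mult (K := R_AbsRing)); auto. }
  assert (H2 : ex_RInt (fun s => cos (IZR k * s + - (PI / 2)) * w1 s) 0 PI).
  { apply (@ex_RInt_continuous R_CompleteNormedModule). intros x Hx.
    apply (continuous_mult (K := R_AbsRing)); auto. }
  assert (Hsh : forall x, cos (x + - (PI / 2)) = sin x).
  { intros x. rewrite <- cos_shift. rewrite <- cos_neg. f_equal. ring. }
  assert (Hparts : IZR k * E + RInt (fun s => cos (IZR k * s + - (PI / 2)) * w1 s) 0 PI = 0).
  { unfold E. apply (@RInt_correct R_CompleteNormedModule) in H1, H2.
    apply (is_RInt_scal (V := R_NormedModule) _ _ _ (IZR k)) in H1.
    pose proof (is_RInt_plus (V := R_NormedModule) _ _ _ _ _ _ H1 H2) as H3.
    apply (@is_RInt_unique R_CompleteNormedModule) in H3.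
    etransitivity; [symmetry; exact H3|].
    apply (@is_RInt_unique R_CompleteNormedModule). evar_last.
    - apply (@is_RInt_derive R_CompleteNormedModule (fun s => sin (IZR k * s) * w s)).
      + intros x Hx. evar_last.
        * apply (@is_derive_mult R_AbsRing (fun s => sin (IZR k * s)) w x).
          -- auto_derive; [trivial|reflexivity].
          -- now apply Hw, Hmm.
          -- intros; apply Rmult_comm.
        * rewrite Hsh. change plus with Rplus.
          change mult with Rmult. change scal with Rmult. cbv beta. ring.
      + intros x Hx. apply (continuous_plus (V := R_NormedModule)).
        * apply (continuous_mult (K := R_AbsRing) (fun _ => IZR k));
          [apply continuous_const|apply (continuous_mult (K := R_AbsRing)); auto].
        * apply (continuous_mult (K := R_AbsRing)); auto.
    - change (sin (IZR k * PI) * w PI - sin (IZR k * 0) * w 0 = 0).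
      rewrite sin_IZR_PI, Rmult_0_r, sin_0. ring. }
  assert (HE0 : Rabs E <= PI * M).
  { replace PI with (PI - 0) at 1 by ring. apply abs_RInt_le_const; auto; [lra|].
    intros t Ht. rewrite Rabs_mult.
    pose proof (HM t Ht). pose proof (Rabs_pos (w t)).
    assert (Rabs (cos (IZR k * t)) <= 1) by (apply Rabs_le, COS_bound).
    pose proof (Rabs_pos (cos (IZR k * t))). nra. }
  assert (HE2 : IZR k ^ 2 * Rabs E <= C).
  { eapply Rle_trans; [|apply (HC (IZR k) (- (PI / 2)))].
    replace (RInt _ 0 PI) with (- (IZR k * E)) by lra.
    rewrite Rabs_Ropp, Rabs_mult, <- (pow2_abs (IZR k)). right. ring. }
  assert (0 < 1 + IZR k ^ 2) by nra.
  apply Rmult_le_reg_r with (1 + IZR k ^ 2); [assumption|].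
  unfold Rdiv. rewrite Rmult_assoc, Rinv_l, Rmult_1_r by lra. lra.
Qed.

(** * Term-by-term integration *)

Lemma series_tail_bound (u b : nat -> R) (l B : R) (N : nat) :
  (forall k, Rabs (u k) <= b k) ->
  is_series u l -> is_series b B -> Rabs (l - sum_n u N) <= B - sum_n b N.
Proof.
  intros Hub Hu Hb.
  assert (Hfin : forall M, Rabs (sum_n u (M + N) - sum_n u N) <= sum_n b (M + N) - sum_n b N).
  { induction M as [|M IH].
    - simpl. rewrite !Rminus_diag, Rabs_R0. lra.
    - simpl. rewrite !sum_Sn. change plus with Rplus.
      replace (sum_n u (M + N) + u (S (M + N)) - sum_n u N)
        with ((sum_n u (M + N) - sum_n u N) + u (S (M + N))) by ring.
      eapply Rle_trans; [apply Rabs_triang|].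
      pose proof (Hub (S (M + N))). lra. }
  apply (is_lim_seq_le (fun M => Rabs (sum_n u (M + N) - sum_n u N))
     (fun M => sum_n b (M + N) - sum_n b N) (Finite _) (Finite _) Hfin).
  - apply (is_lim_seq_abs _ (Finite _)), is_lim_seq_minus'; [|apply is_lim_seq_const].
    apply is_lim_seq_incr_n with (u := sum_n u). exact Hu.
  - apply is_lim_seq_minus'; [|apply is_lim_seq_const].
    apply is_lim_seq_incr_n with (u := sum_n b). exact Hb.
Qed.

Lemma is_RInt_sum_n (f : nat -> R -> R) (a b : R) (N : nat) :
  (forall k, ex_RInt (f k) a b) ->
  is_RInt (fun t => sum_n (fun k => f k t) N) a b (sum_n (fun k => RInt (f k) a b) N).
Proof.
  intros Hf. induction N as [|N IH].
  - rewrite sum_O. apply (is_RInt_ext (f 0%nat)).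
    + intros. now rewrite sum_O.
    + apply (@RInt_correct R_CompleteNormedModule), Hf.
  - rewrite sum_Sn.
    apply (is_RInt_ext (fun t => plus (sum_n (fun k => f k t) N) (f (S N) t))).
    + intros. now rewrite sum_Sn.
    + apply (is_RInt_plus (V := R_NormedModule)); [exact IH|].
      apply (@RInt_correct R_CompleteNormedModule), Hf.
Qed.

(** Term-by-term integration by the Weierstrass test. Pointwise convergence is
    asked for only inside the interval, where the symbol has its closed form. *)
Lemma is_series_RInt (f : nat -> R -> R) (F : R -> R) (b : nat -> R) (a c : R) :
  a <= c ->
  (forall k, ex_RInt (f k) a c) -> ex_RInt F a c ->
  (forall k t, a < t < c -> Rabs (f k t) <= b k) -> ex_series b ->
  (forall t, a < t < c -> is_series (fun k => f k t) (F t)) ->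
  is_series (fun k => RInt (f k) a c) (RInt F a c).
Proof.
  intros Hac Hf HF Hfb [B HB] Hs.
  assert (Hbound : forall N, Rabs (RInt F a c - sum_n (fun k => RInt (f k) a c) N)
             <= (c - a) * (B - sum_n b N)).
  { intros N. pose proof (is_RInt_sum_n f a c N Hf) as HN.
    assert (HFc := @RInt_correct R_CompleteNormedModule _ _ _ HF).
    pose proof (is_RInt_minus (V := R_NormedModule) _ _ _ _ _ _ HFc HN) as Hd.
    assert (Hconst : forall r, is_RInt (fun _ => r) a c ((c - a) * r))
      by (intros r; apply (is_RInt_const (V := R_NormedModule))).
    assert (Hpt : forall t, a < t < c ->
       Rabs (minus (F t) (sum_n (fun k => f k t) N)) <= B - sum_n b N).
    { intros t Ht. apply (series_tail_bound (fun k => f k t) b (F t) B N); auto. }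
    apply Rabs_le. split.
    - apply Rle_trans with ((c - a) * - (B - sum_n b N)); [lra|].
      apply (is_RInt_le _ _ _ _ _ _ Hac (Hconst _) Hd).
      intros t Ht.  pose proof (Hpt t Ht) as H.
      apply Rabs_le_between in H. apply H.
    - apply (is_RInt_le _ _ _ _ _ _ Hac Hd (Hconst _)).
      intros t Ht. pose proof (Hpt t Ht) as H.
      apply Rabs_le_between in H. apply H. }
  apply (is_lim_seq_spec _ (Finite _)). 
  assert (H0 : is_lim_seq (fun N => (c - a) * (B - sum_n b N)) 0).
  { replace (Finite 0) with (Rbar_mult (c - a) (B - B)) by (simpl; f_equal; ring).
    apply (is_lim_seq_scal_l _ _ (Finite _)), is_lim_seq_minus'; [apply is_lim_seq_const|exact HB]. }
  apply is_lim_seq_spec in H0. intros eps. destruct (H0 eps) as [N0 HN0].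
  exists N0. intros N HN. specialize (HN0 N HN). rewrite Rabs_minus_sym.
  eapply Rle_lt_trans; [apply Hbound|]. rewrite Rminus_0_r in HN0.
  eapply Rle_lt_trans; [apply Rle_abs|exact HN0].
Qed.

(** * The symbol of the integer samples *)

Lemma one_le_cosh x : 1 <= cosh x.
Proof.
  unfold cosh. pose proof (exp_ineq1_le x). pose proof (exp_ineq1_le (-x)). lra.
Qed.

Lemma cosh_pos x : 0 < cosh x.
Proof. pose proof (one_le_cosh x). lra. Qed.

Lemma sinh_pos x : 0 < x -> 0 < sinh x.
Proof. intros Hx. rewrite <- sinh_0. now apply sinh_lt. Qed.

Lemma phiL_bounds (sigma x : R) : 0 < sigma ->
  0 <= phiL sigma x <= 1 /\ phiL sigma x <= (1 + sigma ^ 2) / (1 + x ^ 2).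
Proof.
  intros Hs. unfold phiL.
  assert (0 < sigma ^ 2) by nra. assert (0 <= x ^ 2) by nra.
  split; [split|].
  - apply Rdiv_le_0_compat; lra.
  - apply Rle_div_l; lra.
  - apply Rle_div_l; [lra|]. unfold Rdiv. rewrite Rmult_assoc, (Rmult_comm (/ _)), <- Rmult_assoc.
    apply (Rle_div_r _ _ (1 + x ^ 2)); nra.
Qed.

(** Folding k and -k together: the sum over Z of an even function times (-1)^k
    is the sum over the naturals with these weights. *)
Definition alt_weight (k : nat) : R :=
  match k with O => 1 | S _ => 2 * (-1) ^ k end.

(** The product with 2 cos(s/2) telescopes. The alternating signs move the zero
    of the denominator from 0 to PI, so that the kernel is harmless on every
    interval from 0 to x < PI. *)
Lemma alt_dirichlet_kernel (s : R) (N : nat) :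
  sum_n (fun k => alt_weight k * cos (INR k * s)) N * cos (s / 2)
  = (-1) ^ N * cos ((INR N + / 2) * s).
Proof.
  induction N as [|N IH].
  - rewrite sum_O. simpl. rewrite Rmult_0_l, cos_0.
    replace ((0 + / 2) * s) with (s / 2) by field. ring.
  - rewrite sum_Sn. change plus with Rplus. rewrite Rmult_plus_distr_r, IH.
    set (u := INR (S N) * s).
    replace ((INR (S N) + / 2) * s) with (u + s / 2) by (unfold u; field).
    replace ((INR N + / 2) * s) with (u - s / 2) by (unfold u; rewrite S_INR; field).
    rewrite cos_plus, cos_minus. simpl. ring.
Qed.

(** Variation of constants for u'' - sigma^2 u = -(k^2 + sigma^2) cos(k s), whose
    solution cos(k s) has initial data 1 and 0: the kernel sinh(sigma (x - s))
    is the fundamental solution of the operator. *)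
Lemma is_RInt_cos_sinh (sigma k x : R) : 0 < sigma ->
  is_RInt (fun s => cos (k * s) * sinh (sigma * (x - s))) 0 x
    (phiL sigma k / sigma * (cosh (sigma * x) - cos (k * x))).
Proof.
  intros Hs. assert (0 < k ^ 2 + sigma ^ 2) by nra.
  evar_last.
  - apply (@is_RInt_derive R_CompleteNormedModule
      (fun s => (k * sin (k * s) * sinh (sigma * (x - s))
                 - sigma * cos (k * s) * cosh (sigma * (x - s))) / (k ^ 2 + sigma ^ 2))).
    + intros s _. auto_derive; [trivial|]. change (x + - s) with (x - s). field. nra.
    + intros s _. apply ex_derive_continuous_R. now auto_derive.
  - change minus with Rminus. unfold phiL.
    rewrite Rminus_diag, Rminus_0_r, !Rmult_0_r, sin_0, cos_0, sinh_0, cosh_0.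
    field. nra.
Qed.

Lemma ex_series_phiL (sigma : R) : 0 < sigma ->
  ex_series (fun k => 2 * phiL sigma (INR k)).
Proof.
  intros Hs.
  apply (@ex_series_le R_AbsRing R_CompleteNormedModule _
           (fun n => (2 * (1 + sigma ^ 2)) / (1 + INR n ^ 2))); [|apply ex_series_inv_1_sq].
  intros n. destruct (phiL_bounds sigma (INR n) Hs) as [[H1 _] H2].
  change norm with Rabs. rewrite Rabs_pos_eq by lra. unfold Rdiv in *. lra.
Qed.

Lemma Rabs_symbol_term_le (sigma t : R) (k : nat) : 0 < sigma ->
  Rabs (alt_weight k * phiL sigma (INR k) * cos (INR k * t)) <= 2 * phiL sigma (INR k).
Proof.
  intros Hs. destruct (phiL_bounds sigma (INR k) Hs) as [[H1 _] _].
  assert (Rabs (alt_weight k) <= 2).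
  { destruct k as [|k]; unfold alt_weight.
    - rewrite Rabs_R1. lra.
    - rewrite Rabs_mult, pow_1_abs, Rabs_pos_eq; lra. }
  assert (Rabs (cos (INR k * t)) <= 1) by (apply Rabs_le, COS_bound).
  rewrite !Rabs_mult, (Rabs_pos_eq (phiL sigma (INR k))) by assumption.
  pose proof (Rabs_pos (alt_weight k)). pose proof (Rabs_pos (cos (INR k * t))).
  apply Rle_trans with (Rabs (alt_weight k) * phiL sigma (INR k) * 1).
  - apply Rmult_le_compat_l; [nra|assumption].
  - nra.
Qed.

(** Summing [is_RInt_cos_sinh] over k replaces the cosines by the alternating
    Dirichlet kernel; the remaining integral is O(1/N) by [riemann_lebesgue].
    The constant [L] is the value of the symbol at 0. *)
Lemma is_series_symbol_multiple_cosh (sigma : R) : 0 < sigma ->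
  exists L, forall x, 0 < x < PI ->
    is_series (fun k => alt_weight k * phiL sigma (INR k) * cos (INR k * x)) (L * cosh (sigma * x)).
Proof.
  intros Hs.
  set (u := fun x k => alt_weight k * phiL sigma (INR k) * cos (INR k * x)).
  assert (Hex : forall x, ex_series (u x)).
  { intros x. apply (@ex_series_le R_AbsRing R_CompleteNormedModule _
      (fun k => 2 * phiL sigma (INR k))); [|now apply ex_series_phiL].
    intros k. now apply Rabs_symbol_term_le. }
  destruct (Hex 0) as [L HL]. exists L. intros x Hx.
  destruct (Hex x) as [l Hl].
  replace (L * cosh (sigma * x)) with l; [exact Hl|].
  set (g := fun s => sinh (sigma * (x - s)) / cos (s / 2)).
  assert (Hcos : forall s, 0 <= s <= x -> 0 < cos (s / 2)) by (intros s Hsx; apply cos_gt_0; lra).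
  destruct (riemann_lebesgue g (fun s => - sigma * cosh (sigma * (x - s)) / cos (s / 2)
        + sinh (sigma * (x - s)) * sin (s / 2) / (2 * cos (s / 2) ^ 2)) 0 x) as [C HC].
  { lra. }
  { intros s Hsx. pose proof (Hcos s Hsx). unfold g. auto_derive; [lra|].
    change (x + - s) with (x - s). change (s * / 2) with (s / 2). field. lra. }
  { intros s Hsx. pose proof (Hcos s Hsx).
    apply ex_derive_continuous_R. auto_derive.
    repeat split; try lra. simpl. unfold Rdiv in *. nra. }
  assert (Hpart : forall N, sum_n (u 0) N * cosh (sigma * x) - sum_n (u x) N
      = sigma * ((-1) ^ N * RInt (fun s => cos ((INR N + / 2) * s + 0) * g s) 0 x)).
  { intros N.
    assert (Hterm : forall k, is_RInt
        (fun s => alt_weight k * (cos (INR k * s) * sinh (sigma * (x - s)))) 0 x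
        (alt_weight k * (phiL sigma (INR k) / sigma * (cosh (sigma * x) - cos (INR k * x))))).
    { intros k. apply (is_RInt_scal (V := R_NormedModule)). now apply is_RInt_cos_sinh. }
    assert (Hsum := is_RInt_sum_n (fun k s => alt_weight k * (cos (INR k * s) * sinh (sigma * (x - s))))
                      0 x N (fun k => ex_intro _ _ (Hterm k))).
    apply (is_RInt_ext _ (fun s => (-1) ^ N * (cos ((INR N + / 2) * s + 0) * g s))) in Hsum.
    2:{ intros s Hsx. rewrite Rmin_left, Rmax_right in Hsx by lra.
        assert (0 < cos (s / 2)) by (apply Hcos; lra).
        match goal with |- ?p = ?q => change (@eq R p q) end.
        rewrite Rplus_0_r, <- Rmult_assoc, <- alt_dirichlet_kernel. unfold g.
        transitivity (sum_n (fun k => alt_weight k * cos (INR k * s)) N * sinh (sigma * (x - s)));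
          [|field; lra].
        rewrite <- (sum_n_mult_r (K := R_Ring)). apply sum_n_ext. intros k.
        change mult with Rmult. match goal with |- ?p = ?q => change (@eq R p q) end. ring. }
    apply (@is_RInt_unique R_CompleteNormedModule) in Hsum.
    assert (Hg : ex_RInt (fun s => cos ((INR N + / 2) * s + 0) * g s) 0 x).
    { apply (@ex_RInt_continuous R_CompleteNormedModule). intros s Hsx.
      rewrite Rmin_left, Rmax_right in Hsx by lra.
      assert (0 < cos (s / 2)) by (apply Hcos; lra).
      apply ex_derive_continuous_R. unfold g. auto_derive. lra. }
    assert (Hsc := RInt_scal (V := R_CompleteNormedModule) _ 0 x ((-1) ^ N) Hg).
    change scal with Rmult in Hsc. rewrite <- Hsc.
    etransitivity; [|apply f_equal; symmetry; exact Hsum].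
    clear - Hs Hterm.
    induction N as [|N IH].
    - rewrite !sum_O. rewrite (@is_RInt_unique R_CompleteNormedModule _ _ _ _ (Hterm 0%nat)).
      unfold u. rewrite Rmult_0_r, cos_0. field. lra.
    - rewrite !sum_Sn. change plus with Rplus.
      rewrite (@is_RInt_unique R_CompleteNormedModule _ _ _ _ (Hterm (S N))).
      rewrite Rmult_plus_distr_l, <- IH. unfold u at 2 4. rewrite Rmult_0_r, cos_0. field. lra. }
  assert (Hlim0 : is_lim_seq (fun N => sum_n (u 0) N * cosh (sigma * x) - sum_n (u x) N) 0).
  { apply is_lim_seq_abs_0.
    apply (is_lim_seq_le_le (fun _ => 0) _ (fun N => sigma * C * / (INR N + / 2))).
    - intros N. split; [apply Rabs_pos|]. rewrite Hpart. pose proof (pos_INR N).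
      rewrite !Rabs_mult, pow_1_abs, (Rabs_pos_eq sigma) by lra.
      rewrite Rmult_1_l, Rmult_assoc. apply Rmult_le_compat_l; [lra|].
      pose proof (HC (INR N + / 2) 0) as H1. rewrite (Rabs_pos_eq (INR N + / 2)) in H1 by lra.
      apply (Rle_div_r _ _ (INR N + / 2)); [lra|]. rewrite Rmult_comm. exact H1.
    - apply is_lim_seq_const.
    - replace (Finite 0) with (Rbar_mult (sigma * C) 0) by (simpl; f_equal; ring).
      apply is_lim_seq_scal_l.
      apply (is_lim_seq_inv (fun n => INR n + / 2) p_infty); [|discriminate].
      eapply is_lim_seq_plus; [apply is_lim_seq_INR|apply is_lim_seq_const|reflexivity]. }
  assert (Hlim1 : is_lim_seq (fun N => sum_n (u 0) N * cosh (sigma * x) - sum_n (u x) N)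
      (L * cosh (sigma * x) - l)).
  { apply is_lim_seq_minus'; [|exact Hl].
    apply (is_lim_seq_scal_r _ _ (Finite _)). exact HL. }
  apply is_lim_seq_unique in Hlim0. apply is_lim_seq_unique in Hlim1.
  rewrite Hlim0 in Hlim1. injection Hlim1. lra.
Qed.

Lemma RInt_cos_IZR (k : Z) : RInt (fun t => cos (IZR k * t)) 0 PI = PI * kronecker 0 k.
Proof.
  unfold kronecker. destruct (Z.eqb_spec 0 k) as [<-|Hk].
  - rewrite (RInt_ext _ (fun _ => 1)) by (intros; now rewrite Rmult_0_l, cos_0).
    rewrite RInt_const. unfold scal; simpl. unfold mult; simpl. ring.
  - apply not_eq_sym, eq_IZR_contrapositive in Hk.
    apply (@is_RInt_unique R_CompleteNormedModule). evar_last.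
    + apply (@is_RInt_derive R_CompleteNormedModule (fun t => sin (IZR k * t) / IZR k)).
      * intros t _. auto_derive; [trivial|]. field. assumption.
      * intros t _. apply ex_derive_continuous_R. now auto_derive.
    + change minus with Rminus. rewrite sin_IZR_PI, Rmult_0_r, sin_0. field. assumption.
Qed.

(** The constant is fixed by the mean over the interval from 0 to PI: all terms
    but the one of index 0 integrate to 0, while the integral of L cosh(sigma t)
    is L sinh(sigma PI) / sigma. *)
Lemma is_series_symbol (sigma : R) : 0 < sigma ->
  forall x, 0 < x < PI ->
    is_series (fun k => alt_weight k * phiL sigma (INR k) * cos (INR k * x))
      (sigma * PI / sinh (sigma * PI) * cosh (sigma * x)).
Proof.
  intros Hs x Hx.
  destruct (is_series_symbol_multiple_cosh sigma Hs) as [L HL].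
  assert (HPI := PI_RGT_0).
  assert (0 < sinh (sigma * PI)) by (apply sinh_pos; nra).
  replace (sigma * PI / sinh (sigma * PI)) with L; [now apply HL|].
  assert (Hint : is_RInt (fun t => L * cosh (sigma * t)) 0 PI (L * sinh (sigma * PI) / sigma)).
  { evar_last.
    - apply (@is_RInt_derive R_CompleteNormedModule (fun t => L * sinh (sigma * t) / sigma)).
      + intros t _. auto_derive; [trivial|]. field. lra.
      + intros t _. apply ex_derive_continuous_R. now auto_derive.
    - change minus with Rminus. rewrite Rmult_0_r, sinh_0. field. lra. }
  assert (Hser := is_series_RInt
    (fun k t => alt_weight k * phiL sigma (INR k) * cos (INR k * t))
    (fun t => L * cosh (sigma * t)) (fun k => 2 * phiL sigma (INR k)) 0 PI).
  assert (Hcos : forall k : nat, ex_RInt (fun t => cos (INR k * t)) 0 PI).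
  { intros k. apply (@ex_RInt_continuous R_CompleteNormedModule). intros t _.
    apply ex_derive_continuous_R. now auto_derive. }
  specialize (Hser ltac:(lra)).
  specialize (Hser (fun k => ex_RInt_scal (V := R_NormedModule) _ 0 PI _ (Hcos k))).
  specialize (Hser (ex_intro _ _ Hint)).
  specialize (Hser (fun k t _ => Rabs_symbol_term_le sigma t k Hs)).
  specialize (Hser (ex_series_phiL sigma Hs) HL).
  rewrite (@is_RInt_unique R_CompleteNormedModule _ _ _ _ Hint) in Hser.
  assert (Hpi : is_series (fun k => RInt
     (fun t => alt_weight k * phiL sigma (INR k) * cos (INR k * t)) 0 PI) PI).
  { apply (is_lim_seq_ext (fun _ => PI) (sum_n _) (Finite PI)); [|apply is_lim_seq_const].
    assert (Hval : forall k : nat, RInt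
      (fun t => alt_weight k * phiL sigma (INR k) * cos (INR k * t)) 0 PI
      = alt_weight k * phiL sigma (INR k) * (PI * kronecker 0 (Z.of_nat k))).
    { intros k. rewrite <- RInt_cos_IZR, <- INR_IZR_INZ.
      exact (RInt_scal (V := R_CompleteNormedModule) _ 0 PI _ (Hcos k)). }
    induction n as [|n IH].
    - rewrite sum_O, Hval. unfold phiL, kronecker; simpl. field. nra.
    - rewrite sum_Sn, <- IH, Hval. unfold kronecker; simpl Z.eqb. cbv iota.
      change plus with Rplus. ring. }
  apply is_series_unique in Hser. apply is_series_unique in Hpi. rewrite Hpi in Hser.
  rewrite Hser at 1. field. lra.
Qed.

(** * The coefficients of the basic nod function *)

Definition nod_coeff (sigma : R) (k : Z) : R :=
  powerRZ (-1) k * sinh (sigma * PI) / (sigma * PI ^ 2)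
  * RInt (fun t => cos (IZR k * t) / cosh (sigma * t)) 0 PI.

Lemma Rabs_powerRZ_m1 (k : Z) : Rabs (powerRZ (-1) k) = 1.
Proof.
  destruct k as [|p|p]; simpl.
  - apply Rabs_R1.
  - apply pow_1_abs.
  - rewrite Rabs_inv, pow_1_abs. apply Rinv_1.
Qed.

Lemma powerRZ_m1_opp (k : Z) : powerRZ (-1) (- k) = powerRZ (-1) k.
Proof. rewrite powerRZ_neg', <- powerRZ_inv'. f_equal. field. Qed.

Lemma nod_coeff_decay (sigma : R) : 0 < sigma ->
  exists C, forall k, Rabs (nod_coeff sigma k) <= C / (1 + IZR k ^ 2).
Proof.
  intros Hs. assert (HPI := PI_RGT_0).
  assert (0 < sinh (sigma * PI)) by (apply sinh_pos; nra).
  destruct (cosine_coefficients_decay (fun t => / cosh (sigma * t))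
     (fun t => - sigma * sinh (sigma * t) / cosh (sigma * t) ^ 2)
     (fun t => - sigma ^ 2 / cosh (sigma * t)
               + 2 * sigma ^ 2 * sinh (sigma * t) ^ 2 / cosh (sigma * t) ^ 3)) as [C HC].
  - intros t _. pose proof (cosh_pos (sigma * t)). auto_derive; [lra|]. field. lra.
  - intros t _. pose proof (cosh_pos (sigma * t)). auto_derive.
    + apply Rgt_not_eq. simpl. nra.
    + field. lra.
  - intros t _. pose proof (cosh_pos (sigma * t)).
    apply ex_derive_continuous_R. auto_derive.
    repeat split; try lra. apply Rgt_not_eq. 
    repeat (apply Rmult_lt_0_compat; try lra).
  - exists (sinh (sigma * PI) / (sigma * PI ^ 2) * C). intros k. unfold nod_coeff.
    replace (powerRZ (-1) k * sinh (sigma * PI) / (sigma * PI ^ 2)) with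
      (powerRZ (-1) k * (sinh (sigma * PI) / (sigma * PI ^ 2))) by (unfold Rdiv; ring).
    rewrite !Rabs_mult, Rabs_powerRZ_m1, Rmult_1_l.
    assert (0 < sinh (sigma * PI) / (sigma * PI ^ 2)) by
      (apply Rdiv_lt_0_compat; [|apply Rmult_lt_0_compat; [|apply pow_lt]]; assumption).
    rewrite Rabs_pos_eq by lra. unfold Rdiv at 3. rewrite Rmult_assoc.
    apply Rmult_le_compat_l; [lra|]. apply HC.
Qed.

(** Since 2 cos(j t) cos(m t) = cos((m-j) t) + cos((m+j) t), integrating
    [is_series_symbol] times cos(m t) / cosh(sigma t) gives the sum over j >= 0
    of phi(j) (D_{m-j} + D_{m+j}), the term j = 0 halved; splitting it into its
    two halves gives the convolution over Z. *)
Lemma nod_coeff_convolution (sigma : R) (m : Z) : 0 < sigma ->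
  is_Zseries (V := R_NormedModule)
    (fun k => nod_coeff sigma k * phiL sigma (IZR (m - k))) (kronecker 0 m).
Proof.
  intros Hs. assert (HPI := PI_RGT_0).
  assert (Hsh : 0 < sinh (sigma * PI)) by (apply sinh_pos; nra).
  destruct (nod_coeff_decay sigma Hs) as [C HC].
  destruct (ex_Zseries_dominated C
     (fun k => nod_coeff sigma k * phiL sigma (IZR (m - k)))) as [l Hl].
  { intros k. destruct (phiL_bounds sigma (IZR (m - k)) Hs) as [[H1 H2] _].
    rewrite Rabs_mult, (Rabs_pos_eq (phiL _ _)) by assumption.
    eapply Rle_trans; [|apply (HC k)]. pose proof (Rabs_pos (nod_coeff sigma k)). nra. }
  replace (kronecker 0 m) with l; [exact Hl|].
  set (w := fun t => / cosh (sigma * t)).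
  set (E := fun k : Z => RInt (fun t => cos (IZR k * t) * w t) 0 PI).
  assert (Hex : forall k : Z, ex_RInt (fun t => cos (IZR k * t) * w t) 0 PI).
  { intros k. apply (@ex_RInt_continuous R_CompleteNormedModule). intros t _.
    pose proof (cosh_pos (sigma * t)).
    apply ex_derive_continuous_R. unfold w. auto_derive. lra. }
  set (f := fun (j : nat) t =>
     alt_weight j * phiL sigma (INR j) * cos (INR j * t) * (cos (IZR m * t) * w t)).
  assert (Hf : forall j : nat, is_RInt (f j) 0 PI
     (alt_weight j / 2 * phiL sigma (INR j) * (E (m - Z.of_nat j)%Z + E (m + Z.of_nat j)%Z))).
  { intros j.
    apply (is_RInt_ext (fun t => scal (alt_weight j / 2 * phiL sigma (INR j))
       (plus (cos (IZR (m - Z.of_nat j) * t) * w t) (cos (IZR (m + Z.of_nat j) * t) * w t)))).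
    - intros t _. unfold f. change scal with Rmult. change plus with Rplus.
      match goal with |- ?p = ?q => change (@eq R p q) end.
      rewrite minus_IZR, plus_IZR, <- INR_IZR_INZ, Rmult_minus_distr_r, Rmult_plus_distr_r.
      rewrite cos_minus, cos_plus. field.
    - apply (is_RInt_scal (V := R_NormedModule)), (is_RInt_plus (V := R_NormedModule));
        apply (@RInt_correct R_CompleteNormedModule), Hex. }
  assert (HF : is_RInt (fun t => sigma * PI / sinh (sigma * PI) * cos (IZR m * t)) 0 PI
     (sigma * PI / sinh (sigma * PI) * (PI * kronecker 0 m))).
  { rewrite <- RInt_cos_IZR. apply (is_RInt_scal (V := R_NormedModule)).
    apply (@RInt_correct R_CompleteNormedModule), (@ex_RInt_continuous R_CompleteNormedModule).
    intros t _. apply ex_derive_continuous_R. now auto_derive. }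
  assert (Hw : forall t, 0 < w t <= 1).
  { intros t. unfold w. pose proof (one_le_cosh (sigma * t)). split.
    - apply Rinv_0_lt_compat. lra.
    - rewrite <- Rinv_1. apply Rinv_le_contravar; lra. }
  assert (Hser : is_series (fun j => RInt (f j) 0 PI)
     (RInt (fun t => sigma * PI / sinh (sigma * PI) * cos (IZR m * t)) 0 PI)).
  { apply (is_series_RInt f _ (fun j => 2 * phiL sigma (INR j))).
    - lra.
    - intros j. eexists. apply Hf.
    - eexists. apply HF.
    - intros j t _. unfold f. rewrite Rabs_mult.
      pose proof (Rabs_symbol_term_le sigma t j Hs).
      assert (Rabs (cos (IZR m * t) * w t) <= 1).
      { rewrite Rabs_mult, (Rabs_pos_eq (w t)) by (left; apply Hw).
        assert (Rabs (cos (IZR m * t)) <= 1) by (apply Rabs_le, COS_bound).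
        pose proof (Hw t). pose proof (Rabs_pos (cos (IZR m * t))). nra. }
      pose proof (Rabs_pos (cos (IZR m * t) * w t)).
      pose proof (Rabs_pos (alt_weight j * phiL sigma (INR j) * cos (INR j * t))). nra.
    - now apply ex_series_phiL.
    - intros t Ht. pose proof (is_series_symbol sigma Hs t Ht) as H.
      apply (is_series_scal_r (cos (IZR m * t) * w t)) in H.
      replace (sigma * PI / sinh (sigma * PI) * cos (IZR m * t)) with
        (sigma * PI / sinh (sigma * PI) * cosh (sigma * t) * (cos (IZR m * t) * w t));
        [exact H|].
      unfold w. pose proof (cosh_pos (sigma * t)). field. lra. }
  rewrite (@is_RInt_unique R_CompleteNormedModule _ _ _ _ HF) in Hser.
  set (D := nod_coeff sigma) in *. set (p := fun j : nat => phiL sigma (INR j)).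
  (* The term of index 0 counts D_m twice, hence the weight 1/2 there. *)
  assert (Hpair : is_series (fun j : nat => (match j with O => / 2 | S _ => 1 end) *
      (p j * (D (m - Z.of_nat j)%Z + D (m + Z.of_nat j)%Z))) (kronecker 0 m)).
  { apply (is_series_scal_r (powerRZ (-1) m * (sinh (sigma * PI) / (sigma * PI ^ 2)))) in Hser.
    replace (kronecker 0 m) with (sigma * PI / sinh (sigma * PI) * (PI * kronecker 0 m) *
      (powerRZ (-1) m * (sinh (sigma * PI) / (sigma * PI ^ 2)))).
    - eapply is_series_ext; [|exact Hser]. intros j. cbv beta.
      rewrite (@is_RInt_unique R_CompleteNormedModule _ _ _ _ (Hf j)).
      assert (HD : forall k, D k = powerRZ (-1) k * (sinh (sigma * PI) / (sigma * PI ^ 2)) * E k).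
      { intros k. unfold D, nod_coeff, E, w, Rdiv. ring. }
      match goal with |- ?p = ?q => change (@eq R p q) end.
      rewrite !HD. unfold Z.sub. rewrite !powerRZ_add, powerRZ_m1_opp, <- pow_powerRZ by lra.
      fold (p j). destruct j as [|j]; unfold alt_weight; [simpl|]; field; split; lra || nra.
    - unfold kronecker. destruct (Z.eqb_spec 0 m) as [<-|]; simpl; field; lra. }
  destruct (is_Zseries_reflect m _ _ Hl) as [lp [ln [Hp [Hn ->]]]].
  change R in lp, ln.
  assert (Hp' : is_series (fun n => p (S n) * D (m - Z.of_nat (S n))%Z) (lp - p 0%nat * D m)).
  { apply (is_series_incr_1 (fun n => p n * D (m - Z.of_nat n)%Z)).
    change plus with Rplus. rewrite Z.sub_0_r.
    replace (lp - p 0%nat * D m + p 0%nat * D m) with lp by ring.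
    eapply is_series_ext; [|exact Hp]. intros n. cbv beta.
    replace (m - (m - Z.of_nat n))%Z with (Z.of_nat n) by lia.
    rewrite <- INR_IZR_INZ. apply Rmult_comm. }
  assert (Hn' : is_series (fun n => p (S n) * D (m + Z.of_nat (S n))%Z) ln).
  { eapply is_series_ext; [|exact Hn]. intros n. cbv beta.
    replace (m - (m - - Z.of_nat (S n)))%Z with (- Z.of_nat (S n))%Z by lia.
    replace (m - - Z.of_nat (S n))%Z with (m + Z.of_nat (S n))%Z by lia.
    rewrite opp_IZR, <- INR_IZR_INZ. unfold p, phiL.
    replace ((- INR (S n)) ^ 2) with (INR (S n) ^ 2) by ring. apply Rmult_comm. }
  assert (Hpair' : is_series (fun n => p (S n) * (D (m - Z.of_nat (S n))%Z + D (m + Z.of_nat (S n))%Z))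
     (kronecker 0 m - p 0%nat * D m)).
  { apply (is_series_ext (fun n => 1 * (p (S n) * (D (m - Z.of_nat (S n))%Z + D (m + Z.of_nat (S n))%Z))));
      [intros; apply Rmult_1_l|].
    apply (is_series_incr_1 (fun j : nat => (match j with O => / 2 | S _ => 1 end) *
      (p j * (D (m - Z.of_nat j)%Z + D (m + Z.of_nat j)%Z)))).
    change plus with Rplus. simpl Z.of_nat. rewrite Z.sub_0_r, Z.add_0_r.
    replace (kronecker 0 m - p 0%nat * D m + / 2 * (p 0%nat * (D m + D m)))
      with (kronecker 0 m) by field. exact Hpair. }
  pose proof (is_series_plus _ _ _ _ Hp' Hn') as Hsum.
  apply is_series_unique in Hsum. apply is_series_unique in Hpair'.
  rewrite (Series_ext _ (fun n => p (S n) * D (m - Z.of_nat (S n))%Z + p (S n) * D (m + Z.of_nat (S n))%Z)) in Hpair'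
    by (intros; ring).
  change plus with Rplus in *. cbv beta in Hsum.
  pose proof (eq_trans (eq_sym Hpair') Hsum) as Heq. simpl in Heq. lra.
Qed.

Theorem theorem2 (sigma : R) (hsigma : 0 < sigma) :
  (exists (d : Z -> C) (nod : R -> C),
     is_basic_nod (fun t => RtoC (phiL sigma t)) d nod) /\
  (forall (d : Z -> C) (nod : R -> C),
     is_basic_nod (fun t => RtoC (phiL sigma t)) d nod ->
     forall k : Z,
       d k = RtoC (powerRZ (-1) k * sinh (sigma * PI) / (sigma * PI ^ 2)
                   * RInt (fun t => cos (IZR k * t) / cosh (sigma * t)) 0 PI)).
Proof.
  destruct (nod_coeff_decay sigma hsigma) as [B HC].
  split.
  - set (D := nod_coeff sigma).
    assert (Hsum : forall t, is_Zseries (V := R_NormedModule)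
       (fun k => D k * phiL sigma (t - IZR k))
       (real (Lim_seq (zsum (fun k => D k * phiL sigma (t - IZR k)))))).
    { intros t. destruct (ex_Zseries_dominated B (fun k => D k * phiL sigma (t - IZR k))) as [l Hl].
      - intros k. destruct (phiL_bounds sigma (t - IZR k) hsigma) as [[H1 H2] _].
        rewrite Rabs_mult, (Rabs_pos_eq (phiL _ _)) by assumption.
        eapply Rle_trans; [|apply (HC k)]. unfold D.
        pose proof (Rabs_pos (nod_coeff sigma k)). nra.
      - now rewrite (is_lim_seq_unique _ _ (is_lim_zsum _ _ Hl)). }
    exists (fun k => RtoC (D k)),
      (fun t => RtoC (real (Lim_seq (zsum (fun k => D k * phiL sigma (t - IZR k)))))).
    split; [|split].
    + assert (0 <= B).
      { pose proof (HC 0%Z) as H. pose proof (Rabs_pos (nod_coeff sigma 0)).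
        replace (B / (1 + 0 ^ 2)) with B in H by field. lra. }
      apply (ex_Zseries_dominated (B * B)). intros k.
      rewrite Cmod_R, <- RPow_abs, Rabs_Rabsolu. fold D in HC.
      assert (0 < / (1 + IZR k ^ 2) <= 1).
      { assert (0 <= IZR k ^ 2) by nra. split; [apply Rinv_0_lt_compat; lra|].
        rewrite <- Rinv_1. apply Rinv_le_contravar; lra. }
      specialize (HC k). pose proof (Rabs_pos (D k)). unfold Rdiv in *.
      assert (Rabs (D k) <= B) by nra.
      simpl. rewrite Rmult_1_r, Rmult_assoc. 
      apply Rmult_le_compat; assumption.
    + intros t.
      pose proof (is_Zseries_linear (U := R_NormedModule) (V := C_R_NormedModule) (fun x => (x, 0)) _ _
        (is_linear_prod (K := R_AbsRing) (U := R_NormedModule) (V := R_NormedModule) _ _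
          (is_linear_id (V := R_NormedModule)) (is_linear_zero (V := R_NormedModule))) (Hsum t)) as H.
      eapply is_Zseries_ext; [|exact H]. intros k. cbv beta.
      now rewrite <- RtoC_mult.
    + intros m. f_equal.
      pose proof (nod_coeff_convolution sigma m hsigma) as H.
      apply (is_Zseries_ext _ (fun k => D k * phiL sigma (IZR m - IZR k))) in H.
      * now rewrite (is_lim_seq_unique _ _ (is_lim_zsum _ _ H)).
      * intros k. now rewrite minus_IZR.
  - intros d nod [[s Hs] [Hnod Hint]] k. fold (nod_coeff sigma k).
    assert (Hbd : forall j, Cmod (d j) <= 1 + s).
    { intros j.
      pose proof (Zseries_term_le (fun j => Cmod (d j) ^ 2) s j (fun i => pow2_ge_0 _) Hs) as H.
      cbv beta in H. nra. }
    set (p := fun j => phiL sigma (IZR j)).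
    assert (Hp : forall j, Rabs (p j) <= (1 + sigma ^ 2) / (1 + IZR j ^ 2)).
    { intros j. destruct (phiL_bounds sigma (IZR j) hsigma) as [[H1 H2] H3].
      unfold p. now rewrite Rabs_pos_eq. }
    (* The samples of [phiL sigma] are real, so the interpolation conditions
       split into those of the real part (c = 1) and of the imaginary part (c = 0). *)
    assert (Hproj : forall (pr : C -> R) (c : R),
       is_linear (U := C_R_NormedModule) (V := R_NormedModule) pr ->
       (forall z x, pr (Cmult z (RtoC x)) = pr z * x) ->
       (forall z, Rabs (pr z) <= Cmod z) -> pr (RtoC 1) = c ->
       pr (d k) = c * nod_coeff sigma k).
    { intros pr c Hlin Hmul Hle Hc.
      apply (convolution_inverse_unique (nod_coeff sigma) p (fun j => pr (d j))
               (1 + s) B (1 + sigma ^ 2) c); auto.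
      - intros j. eapply Rle_trans; [apply Hle|apply Hbd].
      - intros m. now apply nod_coeff_convolution.
      - intros m. pose proof (is_Zseries_linear pr _ _ Hlin (Hnod (IZR m))) as H.
        rewrite Hint in H. replace (c * kronecker 0 m) with (pr (RtoC (kronecker 0 m))).
        + eapply is_Zseries_ext; [|exact H]. intros j. cbv beta.
          now rewrite Hmul, <- minus_IZR.
        + rewrite <- Hc, <- Hmul. f_equal. now rewrite Cmult_1_l. }
    apply injective_projections.
    + change (Re (d k) = nod_coeff sigma k). rewrite <- (Rmult_1_l (nod_coeff sigma k)).
      apply (Hproj Re).
      * apply (is_linear_fst (U := R_NormedModule) (V := R_NormedModule)).
      * intros z x. unfold Re, Im, Cmult, RtoC. simpl. ring.
      * apply re_le_Cmod.
      * reflexivity.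
    + change (Im (d k) = 0). rewrite <- (Rmult_0_l (nod_coeff sigma k)).
      apply (Hproj Im).
      * apply (is_linear_snd (U := R_NormedModule) (V := R_NormedModule)).
      * intros z x. unfold Re, Im, Cmult, RtoC. simpl. ring.
      * intros z. eapply Rle_trans; [apply Rmax_r|apply Rmax_Cmod].
      * reflexivity.
Qed.
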